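(* Let $(T,\cdot)$ be a discrete semigroup and let $m,n\in\mathbb N$. Let $\vec p=(p_1,\ldots,p_m)$ be an idempotent in $\prod_{i=1}^m\beta T$. For $i\in\{1,\dots,m\}$ let $\tau_i$ be an $S_0$-independent homomorphism from $S_n$ to $T$. Assume that whenever $B_i\in p_i$ for each $i\in\{1,\dots,m\}$, there exists $w\in S_n$ such that $(\tau_1(w),\ldots,\tau_m(w))\in\prod_{i=1}^m B_i$. Let $D$ be a piecewise syndetic subset of $S_0$ and let $F$ be a finite nonempty set of $S_0$-preserving homomorphisms from $S_n$ to $S_0$. Then whenever $B_i\in p_i$ for each $i\in\{1,\dots,m\}$, there exists $w\in S_n$ such that $\nu(w)\in D$ for each $\nu\in F$ and $\tau_i(w)\in B_i$ for each $i\in\{1,\dots,m\}$.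
   Context: $\mathbb A$ is a fixed nonempty finite alphabet, $S_0=\mathbb A^+$ the free semigroup of nonempty words over $\mathbb A$, and $v_1,v_2,\dots$ distinct variables not in $\mathbb A$. $S_n$ is the set of nonempty words over $\mathbb A\cup\{v_1,\dots,v_n\}$ in which each $v_i$ ($i\le n$) occurs, a semigroup under concatenation. A homomorphism $\tau:S_n\to T$ is $S_0$-independent if $\tau(uw)=\tau(w)=\tau(wu)$ for all $w\in S_n,u\in S_0$; a homomorphism $\nu:S_n\to S_0$ is $S_0$-preserving if $\nu(uw)=u\nu(w)$ and $\nu(wu)=\nu(w)u$ for all $u\in S_0,w\in S_n$. For a discrete semigroup $X$, $\beta X$ is its Stone–Čech compactification (ultrafilters) with the extended operation ($A\in pq$ iff $\{x:x^{-1}A\in q\}\in p$), a compact right topological semigroup; $\prod\beta T$ has the product topology and coordinatewise operation. $K(\beta X)$ is the smallest two-sided ideal; $D\subseteq X$ is piecewise syndetic if $D\in p$ for some $p\in K(\beta X)$. *)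

(* Defs.v *)
From HB Require Import structures.
From mathcomp Require Import all_boot.
From mathcomp Require Export mathcomp_extra boolp classical_sets functions.
From mathcomp Require Export cardinality filter.

Set Implicit Arguments.
Unset Strict Implicit.
Unset Printing Implicit Defensive.

Local Open Scope classical_set_scope.
Local Open Scope group_scope.

(* The points of the Stone-Cech compactification of the discrete space X are
   the ultrafilters on X; the topology is not needed here. *)
Record stone_cech (X : Type) := StoneCech {
  sc_sets :> set X -> Prop;
  sc_ultra : UltraFilter sc_sets
}.
#[global] Existing Instance sc_ultra.

Lemma stone_cechP (X : Type) (p q : stone_cech X) :
  (forall A, p A <-> q A) -> p = q.
Proof.
case: p q => [p pU] [q qU] /= pq.
have epq : p = q by apply/seteqP; split=> A /pq.
by case: _ / epq qU => qU; congr StoneCech; exact: Prop_irrelevance.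
Qed.

HB.instance Definition _ (X : Type) := gen_eqMixin (stone_cech X).
HB.instance Definition _ (X : Type) := gen_choiceMixin (stone_cech X).

Section StoneCechSemigroup.
Variable X : semigroupType.

Definition sc_mul_sets (p q : set_system X) : set_system X :=
  [set A | p [set x | q [set y | A (x * y)]]].

Lemma sc_mul_ultra (p q : stone_cech X) : UltraFilter (sc_mul_sets p q).
Proof.
have FF : ProperFilter (sc_mul_sets p q).
  split; last split.
  - move=> p0; have /filter_ex[x qx0] : p [set x | q set0] by exact: p0.
    exact: (@filter_not_empty _ q _ qx0).
  - by apply: (@filterE _ p) => x; exact: (@filterT _ q).
  - move=> B C pB pC; apply: (@filterS2 _ p _ _ _ _ _ pB pC) => x qB qC.
    by apply: (@filterS2 _ q _ _ _ _ _ qB qC) => y By Cy; split.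
  - move=> B C BC pB; apply: (@filterS _ p _ _ _ _ pB) => x qB.
    by apply: (@filterS _ q _ _ _ _ qB) => y; exact: BC.
split=> // G GF pqG; apply/seteqP; split=> // A GA.
have [//|pnA] := in_ultra_setVsetC [set x | q [set y | A (x * y)]] (sc_ultra p).
have /pqG GnA : sc_mul_sets p q (~` A).
  apply: filterS pnA => x /= nqA.
  by have [/nqA|] := in_ultra_setVsetC [set y | A (x * y)] (sc_ultra q).
case: (@filter_not_empty _ G _).
by rewrite -(setICr A); exact: filterI.
Qed.

Definition sc_mul (p q : stone_cech X) := StoneCech (sc_mul_ultra p q).

Lemma sc_mulA : associative sc_mul.
Proof.
move=> p q r; apply: stone_cechP => A; rewrite /= /sc_mul_sets /=.
suff -> : (fun x => q [set y | r [set z | A (x * (y * z))]]) =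
          (fun x => q [set y | r [set z | A (x * y * z)]]) by [].
by under eq_fun do under eq_set do under eq_set do rewrite mulgA.
Qed.

HB.instance Definition _ := isSemigroup.Build (stone_cech X) sc_mulA.

End StoneCechSemigroup.

Definition two_sided_ideal (X : semigroupType) (I : set X) :=
  I !=set0 /\ forall x y, I x -> I (y * x) /\ I (x * y).

(* [smallest] is the intersection of all two-sided ideals, which for
   [stone_cech X] is a nonempty ideal by compactness. *)
Definition smallest_ideal (X : semigroupType) : set X :=
  smallest (@two_sided_ideal X) set0.

Definition piecewise_syndetic (X : semigroupType) (D : set X) :=
  exists2 p : stone_cech X, smallest_ideal p & p D.

Section Words.
Variable A : finType.

(* [inl a] is the letter a and [inr i] is the variable v_(i+1). *)
Notation symbol := (A + nat)%type.

Definition is_vword (n : nat) : pred (seq symbol) := fun w =>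
  [&& w != [::],
      all (fun x => if x is inr i then i < n else true) w &
      all (fun i => inr i \in w) (iota 0 n)].

(* The semigroup S_n; in particular S_0 = [vword 0] consists of the nonempty
   words over A. *)
Record vword (n : nat) := VWord {
  vword_val :> seq symbol;
  _ : is_vword n vword_val
}.

HB.instance Definition _ n := [isSub for @vword_val n].
HB.instance Definition _ n := [Choice of vword n by <:].

Lemma is_vword_cat n u v : is_vword n u -> is_vword n v -> is_vword n (u ++ v).
Proof.
move=> /and3P[u0 un uv] /and3P[v0 vn vv]; apply/and3P; split.
- by case: u u0 {un uv}.
- by rewrite all_cat un.
- by apply: sub_all uv => i; rewrite mem_cat => ->.
Qed.

Lemma is_vword_catl n u w :
  is_vword 0 u -> is_vword n w -> is_vword n (u ++ w).
Proof.
move=> /and3P[u0 un _] /and3P[w0 wn wv]; apply/and3P; split.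
- by case: u u0 {un}.
- by rewrite all_cat wn andbT; apply: sub_all un => -[].
- by apply: sub_all wv => i; rewrite mem_cat orbC => ->.
Qed.

Lemma is_vword_catr n w u :
  is_vword n w -> is_vword 0 u -> is_vword n (w ++ u).
Proof.
move=> /and3P[w0 wn wv] /and3P[u0 un _]; apply/and3P; split.
- by case: w w0 {wn wv}.
- by rewrite all_cat wn; apply: sub_all un => -[].
- by apply: sub_all wv => i; rewrite mem_cat => ->.
Qed.

Definition vword_mul n (u v : vword n) : vword n :=
  VWord (is_vword_cat (valP u) (valP v)).

Definition vword_lmul n (u : vword 0) (w : vword n) : vword n :=
  VWord (is_vword_catl (valP u) (valP w)).

Definition vword_rmul n (w : vword n) (u : vword 0) : vword n :=
  VWord (is_vword_catr (valP w) (valP u)).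

Lemma vword_mulA n : associative (@vword_mul n).
Proof. by move=> u v w; apply: val_inj; rewrite /= catA. Qed.

HB.instance Definition _ n := isSemigroup.Build (vword n) (@vword_mulA n).

Definition S0_independent n (T : Type) (tau : vword n -> T) :=
  forall (u : vword 0) (w : vword n),
    tau (vword_lmul u w) = tau w /\ tau (vword_rmul w u) = tau w.

Definition S0_preserving n (nu : vword n -> vword 0) :=
  forall (u : vword 0) (w : vword n),
    nu (vword_lmul u w) = u * nu w /\ nu (vword_rmul w u) = nu w * u.

End Words.

(* Main.v *)
(** Let [p] lie in the smallest ideal of βS_0 with [D] in [p], and let [e] be a
    minimal idempotent with [p e = p]. In the Stone-Čech compactification of the
    semigroup [S_0 ∪ S_n], the ultrafilters [q] on [S_n] with [tau_i q = p_i] for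
    all [i] form a nonempty closed subsemigroup [J], and by S_0-independence
    [βS_0 J] and [J βS_0] are contained in [J]. Ellis's theorem gives an idempotent
    [r] in [J e], and then [q = e r] is an idempotent of [J] with
    [q e = e q = q]. Each [nu] in [F], extended by the identity of [S_0], is a
    homomorphism, so [nu q] is an idempotent below [e], hence equals [e] by
    minimality. So [nu (p q) = p e = p] for every [nu] in [F], and any
    word in a suitable member of [p q] is as required. *)
From HB Require Import structures.
From mathcomp Require Import all_boot.
Require Import Defs.

Local Open Scope classical_set_scope.
Local Open Scope group_scope.

Lemma filter_bigcap_finite (T I : Type) (F : set_system T) (D : set I)
    (f : I -> set T) : Filter F -> finite_set D ->
  (forall i, D i -> F (f i)) -> F (\bigcap_(i in D) f i).
Proof.
move=> FF /(@finite_fsetP {classic I})[D' ->] FD.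
exact: (@filter_bigI _ {classic I}).
Qed.

(** * Closed sets of ultrafilters and compactness *)

Section StoneCech.
Context {X : Type}.
Implicit Types (p q : stone_cech X) (C : set (stone_cech X)).

Lemma stone_cech_eq p q : (forall B, p B -> q B) -> p = q.
Proof.
move=> pq; apply: stone_cechP => B; split; first exact: pq.
move=> qB; have [//|/pq qnB] := in_ultra_setVsetC B (sc_ultra p).
by have /filter_ex[x []] : q (B `&` ~` B) by exact: filterI.
Qed.

Lemma stone_cechC p B : p (~` B) <-> ~ p B.
Proof.
split=> [pnB pB|npB]; last by have [/npB|] := in_ultra_setVsetC B (sc_ultra p).
by have /filter_ex[x []] : p (B `&` ~` B) by exact: filterI.
Qed.

Lemma stone_cech_ex (G : set_system X) : ProperFilter G ->
  exists p : stone_cech X, G `<=` p.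
Proof. by move=> /ultraFilterLemma[U [UU GU]]; exists (StoneCech UU). Qed.

(* The sets belonging to all members of [C] form a filter; the ultrafilters above
   it are the closure of [C]. *)
Definition sc_closed C :=
  forall p, (forall B, (forall q, C q -> q B) -> p B) -> C p.

Lemma sc_closed_above (G : set_system X) :
  sc_closed [set p : stone_cech X | G `<=` p].
Proof. by move=> p pG B GB; apply: pG => q; exact. Qed.

Lemma sc_closed_bigcap (I : Type) (P : set I) (C : I -> set (stone_cech X)) :
  (forall i, P i -> sc_closed (C i)) -> sc_closed (\bigcap_(i in P) C i).
Proof.
move=> cC p clp i Pi; apply: cC => // B CB.
by apply: clp => q Cq; apply: CB; exact: Cq.
Qed.

Lemma sc_closedI C C' : sc_closed C -> sc_closed C' -> sc_closed (C `&` C').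
Proof.
move=> cC cC' p clp; split; [apply: cC => B CB|apply: cC' => B CB];
  by apply: clp => q [Cq C'q]; exact: CB.
Qed.

(** Compactness along chains: the sets common to all members of some [C] in [K] form a proper
    filter, and any ultrafilter above it lies in every closed [C]. *)
Lemma sc_closed_chain (K : set (set (stone_cech X))) :
  K !=set0 -> total_on K subset ->
  (forall C, K C -> sc_closed C /\ C !=set0) -> \bigcap_(C in K) C !=set0.
Proof.
move=> [C0 KC0] totK KC.
pose G : set_system X := [set B | exists2 C, K C & forall q, C q -> q B].
have GF : ProperFilter G.
  split; last split.
  - move=> [C /KC[_ [q Cq]]] /(_ q Cq) q0.
    exact: (filter_not_empty q q0).
  - by exists C0 => // q _; exact: filterT.
  - move=> B1 B2 [C1 K1 CB1] [C2 K2 CB2].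
    by have [C12|C21] := totK _ _ K1 K2;
      [exists C1|exists C2] => // q Cq; apply: filterI; auto.
  - move=> B1 B2 B12 [C K1 CB]; exists C => // q Cq.
    by apply: filterS B12 _; exact: CB.
have [p Gp] := stone_cech_ex _ GF.
exists p => C /[dup] CK /KC[cC _]; apply: cC => B CB.
by apply: Gp; exists C.
Qed.

(** [Zorn_bigcup] bounds chains by unions, so it is applied to the sets [U] removed from [S]. The
    property [Q] will be that of a subsemigroup or of a left ideal. *)
Lemma sc_closed_minimal (Q : set (set (stone_cech X))) S :
  (forall K, K `<=` Q -> Q (\bigcap_(C in K) C)) ->
  sc_closed S -> S !=set0 -> Q S ->
  exists M, [/\ M `<=` S, sc_closed M, M !=set0, Q M &
    forall N, N `<=` M -> sc_closed N -> N !=set0 -> Q N -> M `<=` N].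
Proof.
move=> Qcap cS S0 QS.
pose P U := [/\ sc_closed (S `\` U), S `\` U !=set0 & Q (S `\` U)].
have [H HP totH|U [[cU U0 QU] maxU]] := @Zorn_bigcup _ P.
  (* Adding [set0] puts [S] itself into the family, which is thus nonempty even for an empty chain
     [H]. *)
  pose K := [set S `\` U | U in set0 |` H].
  have KP C : K C -> [/\ sc_closed C, C !=set0 & Q C].
    by move=> [U [->|/HP PU] <-] //; rewrite setD0.
  have -> : \bigcup_(U in H) U = \bigcup_(U in set0 |` H) U.
    by rewrite bigcup_setU1 set0U.
  have EK : S `\` \bigcup_(U in set0 |` H) U = \bigcap_(C in K) C.
    apply/seteqP; split=> [p [Sp nUp] _ [U HU <-]|p Kp].
      by split=> // Up; apply: nUp; exists U.
    split=> [|[U HU Up]].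
      by have [] : (S `\` set0) p by apply: Kp; exists set0 => //; left.
    by have [] : (S `\` U) p by apply: Kp; exists U.
  rewrite /P EK; split.
  - by apply: sc_closed_bigcap => C /KP[].
  - apply: sc_closed_chain => [||C /KP[]//].
      by exists (S `\` set0), set0 => //; left.
    move=> _ _ [U1 HU1 <-] [U2 HU2 <-].
    have [U12|U21] : U1 `<=` U2 \/ U2 `<=` U1.
    + case: HU1 HU2 => [->|H1] [->|H2]; [by left|by left|by right|exact: totH].
    + by right; exact: setDS.
    + by left; exact: setDS.
  - by apply: Qcap => C /KP[].
exists (S `\` U); split=> // N NM cN N0 QN p [Sp nUp].
apply: contrapT => nNp; apply: (maxU (~` N)).
  split=> [q Uq Nq|UN]; first by have [_] := NM _ Nq.
  by apply: nUp; exact: UN.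
have -> : P (~` N) = [/\ sc_closed N, N !=set0 & Q N]; last by [].
rewrite /P setDE setCK (_ : S `&` N = N)//.
by apply/setIidPr => q /NM[].
Qed.

End StoneCech.

(** * Continuous maps: fibers and images *)

Section Continuous.
Context {X Y : Type} (phi : stone_cech X -> stone_cech Y).

(* [g] is the preimage operation on clopen sets. *)
Definition sc_continuous :=
  exists g : set Y -> set X, forall p B, phi p B <-> p (g B).

Hypothesis phi_cont : sc_continuous.

Lemma sc_closed_fiber y : sc_closed [set p | phi p = y].
Proof.
have [g phig] := phi_cont.
move=> p clp; apply/esym/stone_cech_eq => B yB.
by apply/phig; apply: clp => q qy; apply/phig; rewrite qy.
Qed.

(** For [p] in the closure of the image, [G] is generated by the sets common to all of [C] and the
    preimages of members of [p]. An ultrafilter above [G] is a point of [C] sent to [p]. *)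
Lemma sc_closed_image C : sc_closed C -> sc_closed (phi @` C).
Proof.
have [g phig] := phi_cont.
move=> cC p clp.
pose G : set_system X :=
  [set B | exists2 B', p B' & forall q, C q -> phi q B' -> q B].
have GF : ProperFilter G.
  split; last split.
  - move=> [B pB CB]; suff /stone_cechC : p (~` B) by [].
    apply: clp => _ [q Cq <-]; apply/stone_cechC => /(CB q Cq) q0.
    exact: (filter_not_empty q q0).
  - by exists setT => [|q _ _]; exact: filterT.
  - move=> B1 B2 [B1' pB1 CB1] [B2' pB2 CB2].
    exists (B1' `&` B2') => [|q Cq qB]; first exact: filterI.
    apply: filterI; [apply: CB1|apply: CB2] => //;
      by apply: filterS qB => x [].
  - move=> B1 B2 B12 [B1' pB1 CB1]; exists B1' => // q Cq qB.
    by apply: filterS B12 _; exact: CB1.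
have [q Gq] := stone_cech_ex _ GF.
exists q.
  apply: cC => B CB; apply: Gq; exists setT => [|q' Cq' _]; first exact: filterT.
  exact: CB.
apply/esym/stone_cech_eq => B pB; apply/phig; apply: Gq.
by exists B => // q' _ /phig.
Qed.

End Continuous.

(** * Idempotents and the smallest ideal *)

Section Ellis.
Context {X : semigroupType}.
Implicit Types (p q : stone_cech X) (C : set (stone_cech X)).

Lemma sc_mulr_continuous q : sc_continuous (fun p => p * q).
Proof. by exists (fun B => [set x | q [set y | B (x * y)]]). Qed.

Lemma sc_closed_mulr q C : sc_closed C -> sc_closed [set p * q | p in C].
Proof. exact/sc_closed_image/sc_mulr_continuous. Qed.

(** Take [x] in a minimal closed subsemigroup [M]. Minimality gives [M x = M], so some [y] in [M]
    has [y * x = x]; the solutions of this equation in [M] form a closed subsemigroup, hence all of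
    [M], and [x] is one of them. *)
Lemma ellis C : sc_closed C -> C !=set0 ->
  (forall p q, C p -> C q -> C (p * q)) -> exists2 e, C e & e * e = e.
Proof.
move=> cC C0 mC.
pose Q C := forall p q : stone_cech X, C p -> C q -> C (p * q).
have [||M [MC cM [x Mx] mM minM]] := @sc_closed_minimal _ Q _ _ cC C0.
- by move=> K KQ p q Kp Kq C' KC'; apply: KQ => //; [exact: Kp|exact: Kq].
- exact: mC.
exists x; first exact: MC.
have [y My yx] : [set p * x | p in M] x.
  apply: minM (Mx) => [_ [p Mp <-]|||_ _ [p Mp <-] [q Mq <-]].
  - exact: mM.
  - exact: sc_closed_mulr.
  - by exists (x * x), x.
  - by exists (p * x * q); [exact: mM (mM _ _ Mp Mx) Mq|rewrite !mulgA].
have [] // : (M `&` [set p | p * x = x]) x.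
apply: minM (Mx) => [p []//|||p q [Mp px] [Mq qx]].
- by apply: sc_closedI => //; exact/sc_closed_fiber/sc_mulr_continuous.
- by exists y.
- by split; [exact: mM|rewrite /= -mulgA qx].
Qed.

(** The points with this property form a two-sided ideal, so they include the smallest one. *)
Lemma smallest_ideal_minimal p : smallest_ideal p ->
  forall q, exists r, r * (q * p) = p.
Proof.
move/(_ [set p | forall q, exists r, r * (q * p) = p]); apply.
split=> //; split.
  (* Nonemptiness: any point [x] of a minimal closed left ideal [M] has the property, since the
     closed left ideal generated by [q * x] fills [M]. *)
  pose Q C := forall p q : stone_cech X, C q -> C (p * q).
  have [||||M [_ cM [x Mx] iM minM]] := @sc_closed_minimal _ Q setT.
  - by move=> K KQ q r Kr C KC; apply: KQ => //; exact: Kr.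
  - by [].
  - by exists p.
  - by [].
  exists x => q.
  have [r _ rq] : [set r * (q * x) | r in setT] x; last by exists r.
  apply: minM (Mx) => [_ [r _ <-]|||r _ [s _ <-]].
  - exact: (iM _ _ (iM _ _ Mx)).
  - exact: sc_closed_mulr.
  - by exists (q * (q * x)), q.
  - by exists (r * s) => //; rewrite -mulgA.
move=> x y minx; split=> q.
  have [r rE] := minx (q * y).
  by exists (y * r); rewrite -mulgA [q * _]mulgA rE.
have [r rE] := minx q.
by exists r; rewrite !mulgA -(mulgA r) rE.
Qed.

Lemma smallest_ideal_idempotent p : smallest_ideal p ->
  exists e, [/\ p * e = p, e * e = e &
    forall f, f * f = f -> f * e = f -> e * f = f -> f = e].
Proof.
move=> /smallest_ideal_minimal minp.
have [|||_ [y _ <-] idem] := ellis [set q * p | q in setT].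
- exact: sc_closed_mulr.
- by exists (p * p), p.
- move=> _ _ [q _ <-] [r _ <-].
  by exists (q * p * r) => //; rewrite !mulgA.
exists (y * p); split=> // [|f ff fe ef].
  by have [z {1 3}<-] := minp y; rewrite -mulgA idem.
(* Since [f * (y * p) = f], this says [z * f = p]. So [e = g * f] with [g = y * z], and then
   [f = e * f = g * f * f = g * f = e]. *)
have [z zE] := minp (f * y).
have gfe : y * z * f = y * p.
  by rewrite -fe -{2}zE !mulgA.
by rewrite -ef -gfe -mulgA ff.
Qed.

End Ellis.

(** * Extending maps to ultrafilters and to S_0 ∪ S_n *)

Section Map.
Context {X Y : Type} (f : X -> Y).

Lemma sc_map_ultra (p : stone_cech X) :
  UltraFilter [set B | p (f @^-1` B)].
Proof.
have FF : ProperFilter [set B | p (f @^-1` B)].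
  split; first exact: (filter_not_empty p).
  split=> [|B C|B C BC]; first exact: (@filterT _ p).
    exact: (@filterI _ p).
  by apply: (@filterS _ p) => x; exact: BC.
split=> // G GF pG; apply/seteqP; split=> // B GB.
apply: contrapT => /stone_cechC /(pG (~` B)) GnB.
by have /filter_ex[x []] : G (B `&` ~` B) by exact: filterI.
Qed.

Definition sc_map p := StoneCech (sc_map_ultra p).

End Map.

Lemma sc_mapM (X Y : semigroupType) (f : X -> Y) :
  {morph f : x y / x * y} -> {morph sc_map f : p q / p * q}.
Proof.
move=> fM p q; apply: stone_cechP => B /=; rewrite /sc_mul_sets /preimage /=.
by under eq_set do under eq_set do rewrite fM.
Qed.

(* The semigroup S_0 ∪ S_n. *)
Definition mixed_word (A : finType) (n : nat) := (vword A 0 + vword A n)%type.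

Section MixedWords.
Context {A : finType} {n : nat}.

HB.instance Definition _ := Choice.on (mixed_word A n).

Definition mixed_const (u : vword A 0) : mixed_word A n := inl u.

Definition mixed_mul (x y : mixed_word A n) : mixed_word A n :=
  match x, y with
  | inl u, inl v => inl (u * v)
  | inl u, inr w => inr (vword_lmul u w)
  | inr w, inl u => inr (vword_rmul w u)
  | inr w, inr w' => inr (w * w')
  end.

Lemma mixed_mulA : associative mixed_mul.
Proof.
by move=> [x|x] [y|y] [z|z] /=; congr (_ _); apply: val_inj; rewrite /= catA.
Qed.

HB.instance Definition _ := isSemigroup.Build (mixed_word A n) mixed_mulA.

Definition mixed_extend (nu : vword A n -> vword A 0) (x : mixed_word A n) :=
  match x with inl u => u | inr w => nu w end.

(** S_0-preservation is exactly what the two mixed products require. *)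
Lemma mixed_extendM (nu : {multiplicative vword A n -> vword A 0}) :
  S0_preserving nu -> {morph mixed_extend nu : x y / x * y}.
Proof.
move=> nuP [u|w] [v|w'] //=; last exact: gmulfM.
- by have [] := nuP u w'.
- by have [] := nuP v w.
Qed.

End MixedWords.

(** * The subsemigroup J of ultrafilters lying over the p_i *)

Section Tracking.
Context {A : finType} {n m : nat} {T : semigroupType}.
Variables (p : 'I_m -> stone_cech T)
  (tau : 'I_m -> {multiplicative vword A n -> T}).

(** An ultrafilter contains this filter base's supersets exactly when it concentrates on S_n and
    each [tau i] carries it to [p i]. *)
Definition tracking_sets : set_system (mixed_word A n) :=
  [set E | exists2 B : 'I_m -> set T, forall i, p i (B i) &
     forall w, (forall i, B i (tau i w)) -> E (inr w)].

Definition tracking : set (stone_cech (mixed_word A n)) :=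
  [set q | tracking_sets `<=` q].

Lemma tracking_nonempty :
  (forall B : 'I_m -> set T, (forall i, p i (B i)) ->
     exists w : vword A n, forall i, B i (tau i w)) -> tracking !=set0.
Proof.
move=> ptau; suff : ProperFilter tracking_sets by exact: stone_cech_ex.
split; last split.
- by move=> [B /ptau[w Bw]] /(_ w Bw).
- by exists (fun=> setT) => // i; exact: filterT.
- move=> E1 E2 [B1 pB1 BE1] [B2 pB2 BE2].
  exists (fun i => B1 i `&` B2 i) => [i|w Bw]; first exact: filterI.
  by split; [apply: BE1 => i|apply: BE2 => i]; have [] := Bw i.
- move=> E1 E2 E12 [B pB BE]; exists B => // w Bw.
  by apply: E12; exact: BE.
Qed.

Lemma trackingM : (forall i, p i * p i = p i) ->
  forall q r, tracking q -> tracking r -> tracking (q * r).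
Proof.
move=> pp q r Jq Jr E [B pB BE]; apply: Jq.
(* Unfolding [p i * p i = p i] splits [B i] into a condition on the first factor, met by [q], and
   then one on the second, met by [r]. *)
exists (fun i => [set x | p i [set y | B i (x * y)]]) => [i|w Bw].
  by have := pB i; rewrite -{1}pp.
apply: Jr; exists (fun i => [set y | B i (tau i w * y)]) => // w' Bw'.
by apply: BE => i; rewrite gmulfM; exact: Bw'.
Qed.

Hypothesis tau_indep : forall i, S0_independent (tau i).

(** Prefixing a constant [v] leaves every [tau i w] unchanged, so the condition holds for all [v],
    whatever [u] is. *)
Lemma tracking_lmul (u : stone_cech (vword A 0)) q :
  tracking q -> tracking (sc_map mixed_const u * q).
Proof.
move=> Jq E [B pB BE]; apply: (@filterE _ u) => v; apply: Jq.
exists B => // w Bw; apply: BE => i.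
by have [-> _] := tau_indep i v w.
Qed.

Lemma tracking_rmul (u : stone_cech (vword A 0)) q :
  tracking q -> tracking (q * sc_map mixed_const u).
Proof.
move=> Jq E [B pB BE]; apply: Jq; exists B => // w Bw.
apply: (@filterE _ u) => v; apply: BE => i.
by have [_ ->] := tau_indep i v w.
Qed.

End Tracking.

Theorem theorem2p8 (A : finType) (hA : (0 < #|A|)%N)
  (T : semigroupType) (m n : nat) (hm : (0 < m)%N) (hn : (0 < n)%N)
  (p : {ffun 'I_m -> stone_cech T}) (hp : p * p = p)
  (tau : 'I_m -> {multiplicative vword A n -> T})
  (htau : forall i, S0_independent (tau i))
  (hptau : forall B : 'I_m -> set T, (forall i, p i (B i)) ->
     exists w : vword A n, forall i, B i (tau i w))
  (D : set (vword A 0)) (hD : piecewise_syndetic D)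
  (F : set {multiplicative vword A n -> vword A 0})
  (hFfin : finite_set F) (hF0 : F !=set0)
  (hF : forall nu, F nu -> S0_preserving nu) :
  forall B : 'I_m -> set T, (forall i, p i (B i)) ->
    exists w : vword A n,
      (forall nu, F nu -> D (nu w)) /\ (forall i, B i (tau i w)).
Proof.
move=> B pB.
have pp i : p i * p i = p i by rewrite -{3}hp ffunE.
have [d /smallest_ideal_idempotent[e [de ee mine]] dD] := hD.
pose iota : stone_cech (vword A 0) -> stone_cech (mixed_word A n) :=
  sc_map mixed_const.
have iotaM : {morph iota : x y / x * y} by exact: sc_mapM.
pose J : set (stone_cech (mixed_word A n)) := tracking p tau.
have [j Jj] : J !=set0 by exact: tracking_nonempty.
have Je q : J q -> J (q * iota e) by exact: tracking_rmul.
have eJ u q : J q -> J (iota u * q) by exact: tracking_lmul.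
have JM q r : J q -> J r -> J (q * r) by exact: trackingM.
have [|||_ [s Js <-]] := ellis [set q * iota e | q in J].
- exact/sc_closed_mulr/sc_closed_above.
- by exists (j * iota e), j.
- move=> _ _ [q Jq <-] [r Jr <-]; exists (q * iota e * r).
    by apply: JM => //; exact: Je.
  by rewrite !mulgA.
set r := s * iota e => rr.
have re : r * iota e = r by rewrite /r -mulgA -iotaM ee.
have Jr : J r by exact: Je.
pose q := iota e * r.
have eq : iota e * q = q by rewrite /q mulgA -iotaM ee.
have qe : q * iota e = q by rewrite /q -mulgA re.
(* Writing [e] for [iota e]: [e r e r = e r r = e r], as [r e = r]. *)
have qq : q * q = q by rewrite {1}/q -mulgA {1}/q (mulgA r) re rr.
have Jdq : J (iota d * q) by exact/eJ/eJ.
have nu_dq nu : F nu -> sc_map (mixed_extend nu) (iota d * q) = d.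
  move=> /hF /mixed_extendM /sc_mapM nuM.
  have nu_iota u : sc_map (mixed_extend nu) (iota u) = u by exact: stone_cechP.
  rewrite nuM nu_iota (mine (sc_map (mixed_extend nu) q)) //.
  - by rewrite -nuM qq.
  - by rewrite -{1}(nu_iota e) -nuM qe.
  - by rewrite -{1}(nu_iota e) -nuM eq.
(* Each preimage lies in [iota d * q] because its image under [nu] is [d], which contains [D];
   finiteness of [F] allows the intersection. *)
have qD : (iota d * q)%g (\bigcap_(nu in F) (mixed_extend nu @^-1` D)).
  apply: filter_bigcap_finite => // nu Fnu.
  by have := dD; rewrite -{1}(nu_dq nu Fnu).
(* Members of [J] concentrate on S_n, so the word found is a variable word and not a constant. *)
have qB : (iota d * q)%g [set x | exists2 w, x = inr w & forall i, B i (tau i w)].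
  by apply: Jdq; exists B => // w Bw; exists w.
have [x [Dx [w xw Bw]]] := filter_ex (filterI qD qB).
by exists w; split=> // nu /Dx; rewrite xw.
Qed.
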